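(* Let $T$ be a connected topological space. Let $\mathcal{F}$ and $\mathcal{F}'$ be two families of non-empty connected subsets of $T$ such that $\mathcal{F}'$ is a closed augmentation family for $\mathcal{F}$. If $\bigcup_{S\in\mathcal{S}}S\neq T$ for every finite subfamily $\mathcal{S}$ of $\mathcal{F}'$, then $$\operatorname{int-asdim}(\mathcal{F}')\le\operatorname{int-asdim}(\mathcal{F})\le\max\{\operatorname{int-asdim}(\mathcal{F}'),1\}.$$
   Context: Families are multisets. For a subset $S$ of a topological space, a set $W$ is an augmentation of $S$ if $\partial W\subseteq S\subseteq W$, where $\partial W$ is the topological boundary of $W$. For families $\mathcal{F},\mathcal{F}'$ of subsets of a topological space, an augmentation of $\mathcal{F}$ is a bijection $\omega:\mathcal{F}\to\mathcal{F}'$ such that $\omega(S)$ is an augmentation of $S$ for every $S\in\mathcal{F}$; $\mathcal{F}'$ is an augmentation family for $\mathcal{F}$ if such a bijection exists, and it is closed if every element of $\mathcal{F}'$ is a closed set. The intersection graph of a family $\mathcal{A}$ of sets is the (finite or infinite) simple graph with vertex set $\mathcal{A}$ in which two distinct vertices (members) $S_1,S_2$ are adjacent iff $S_1\cap S_2\neq\emptyset$. For a family $\mathcal{A}$ of sets, $\operatorname{int-asdim}(\mathcal{A})$ is the asymptotic dimension of the class of the intersection graphs of all (finite or infinite) subfamilies of $\mathcal{A}$. A graph $G$ is viewed as an extended metric space (distances may be $+\infty$) $(V(G),\operatorname{dist}_G)$, where $\operatorname{dist}_G(u,v)$ is the infimum of the number of edges of paths between $u$ and $v$. In an extended metric space $(X,d)$: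 $\operatorname{diam}(U)=\sup_{x,y\in U}d(x,y)$; for $r>0$ a collection $\mathcal{U}$ of subsets is $r$-disjoint if $\inf_{u\in U,u'\in U'}d(u,u')>r$ for all distinct $U,U'\in\mathcal{U}$. For an integer $m\ge 0$, a function $f:\mathbb{R}_+\to\mathbb{R}_+$ is an $m$-dimensional control function for $(X,d)$ if for every positive integer $r$ there is a cover $\mathcal{U}=\bigcup_{i=1}^{m+1}\mathcal{U}_i$ of $X$ with $\operatorname{diam}(U)\le f(r)$ for all $U\in\mathcal{U}$ and each $\mathcal{U}_i$ being $r$-disjoint. A class $\mathcal{G}$ of (finite or infinite) graphs has asymptotic dimension at most $m$ if some single function $f:\mathbb{R}_+\to\mathbb{R}_+$ is an $m$-dimensional control function for all graphs in $\mathcal{G}$; its asymptotic dimension is the least such integer $m\ge 0$ ($\infty$ if none exists). *)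

(* Defs.v *)
From HB Require Import structures.
From mathcomp Require Import all_boot all_order all_algebra.
From mathcomp Require Import all_classical all_reals all_analysis.

Set Implicit Arguments.
Unset Strict Implicit.
Unset Printing Implicit Defensive.

Import Order.TTheory GRing.Theory Num.Theory.

Local Open Scope classical_set_scope.
Local Open Scope ring_scope.

(* A family (multiset) of subsets of [T] is an indexed family [F : I -> set T]
   over an arbitrary index type; the members of the multiset are the indices,
   so the same set may occur several (possibly infinitely many) times. *)

Section Augmentation.
Variable T : topologicalType.

Definition boundary (W : set T) : set T := closure W `\` interior W.

Definition augmentation (S W : set T) : Prop := boundary W `<=` S /\ S `<=` W.

Definition family_augmentation (I J : Type) (F : I -> set T) (F' : J -> set T)
    (omega : I -> J) : Prop :=
  bijective omega /\ forall i, augmentation (F i) (F' (omega i)).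

Definition augmentation_family (I J : Type) (F : I -> set T) (F' : J -> set T)
    : Prop :=
  exists omega : I -> J, family_augmentation F F' omega.

Definition closed_family (J : Type) (F' : J -> set T) : Prop :=
  forall j, closed (F' j).

End Augmentation.

Record graph := Graph {
  vertex : Type;
  adj : rel vertex;
  adj_sym : symmetric adj;
  adj_irr : irreflexive adj
}.

(* [u :: p] is a path from [u] to [v] (no repeated vertex); it has [size p]
   edges.  [{classic _}] only provides the decidable equality needed by [uniq]. *)
Definition is_path (G : graph) (u v : vertex G) (p : seq (vertex G)) : Prop :=
  [/\ path (@adj G) u p, last u p = v & uniq (u :: p : seq {classic vertex G})].

(* +oo when [u] and [v] are in different components *)
Definition gdist (R : realType) (G : graph) (u v : vertex G) : \bar R :=
  ereal_inf [set (size p)%:R%:E | p in is_path u v].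

(* In this section [d] is meant to be an extended metric on [X]. *)
Section ExtendedMetric.
Variables (R : realType) (X : Type) (d : X -> X -> \bar R).

Definition diam (U : set X) : \bar R :=
  ereal_sup [set d xy.1 xy.2 | xy in U `*` U].

Definition set_dist (U V : set X) : \bar R :=
  ereal_inf [set d xy.1 xy.2 | xy in U `*` V].

Definition r_disjoint (r : R) (C : set (set X)) : Prop :=
  forall U V, C U -> C V -> U <> V -> (r%:E < set_dist U V)%E.

Definition control_function (m : nat) (f : {nonneg R} -> {nonneg R}) : Prop :=
  forall r : nat, (0 < r)%N ->
  exists C : 'I_m.+1 -> set (set X),
    [/\ \bigcup_i \bigcup_(U in C i) U = [set: X],
        forall i U, C i U -> (diam U <= (f r%:R%:nng)%:num%:E)%E
      & forall i, r_disjoint r%:R (C i)].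

End ExtendedMetric.

(* Classes of graphs are [graph -> Prop] rather than [set graph] to keep the
   universe of [graph] independent of that of [set]. *)
Definition asdim_atmost (R : realType) (Gs : graph -> Prop) (m : nat) : Prop :=
  exists f : {nonneg R} -> {nonneg R},
    forall G, Gs G -> control_function (@gdist R G) m f.

(* the least [m] with [asdim_atmost R Gs m], and +oo if there is none *)
Definition asdim (R : realType) (Gs : graph -> Prop) : \bar R :=
  ereal_inf [set m%:R%:E | m in asdim_atmost R Gs].

Section IntersectionGraph.
Variables (T I : Type) (F : I -> set T).

Definition meets : rel I := fun i j => `[< i <> j /\ F i `&` F j !=set0 >].

Lemma meets_sym : symmetric meets.
Proof.
move=> i j; apply/asboolP/asboolP => -[ij ne];
  by split; [exact: nesym | rewrite setIC].
Qed.

Lemma meets_irr : irreflexive meets.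
Proof. by move=> i; apply/asboolP => -[]. Qed.

Definition intersection_graph : graph := Graph meets_sym meets_irr.

End IntersectionGraph.

Definition subfamily (T I : Type) (F : I -> set T) (D : set I) : D -> set T :=
  fun i => F (val i).

Definition int_asdim (R : realType) (T I : Type) (F : I -> set T) : \bar R :=
  asdim R (fun G => exists D : set I,
    G = intersection_graph (subfamily F (D := D))).

(* Main.v *)
Require Import Defs.
From mathcomp Require Import all_boot all_order all_algebra.
From mathcomp Require Import all_classical all_reals all_analysis.
From mathcomp Require Import zify.

Set Implicit Arguments.
Unset Strict Implicit.
Unset Printing Implicit Defensive.

Import Order.TTheory GRing.Theory Num.Theory.

Local Open Scope classical_set_scope.
Local Open Scope ring_scope.

(* If the augmentations W_i, W_j of F_i, F_j meet, then F_i and F_j meet or one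
   of W_i, W_j lies in a hole of the other's original set: connectedness
   confines each of these sets to one side of the boundary of the other, and
   the remaining configuration would make the union of W_i and W_j clopen.
   Lying in a hole is a strict order, and the two intersection graphs agree on
   antichains.

   Asymptotic dimension is read as: the vertices can be coloured with m + 1
   colours so that monochromatic r-chains are bounded.  By compactness only
   finite subfamilies matter.  For these, sending a member to a maximal member
   above it retracts the graph of the augmentations, within distance 1, onto an
   antichain; this gives the first inequality.

   For the second one, a finite subfamily is peeled recursively: the
   neighbourhood of its maximal members, which form an isometric antichain,
   is a piece, and every component of what remains lies in a hole of some
   maximal y, near which all its contacts with the outside take place.  The
   pieces thus form a tree glued along bounded sets.  They are coloured by the
   colouring of the antichain, except that a ball around each attaching point
   takes the colour of that point and an annulus around this ball takes another
   colour.  Such collars stop chains from descending the tree, at the price of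
   a second colour. *)

(** * Chains and walks in a graph *)

Inductive star {V : Type} (Q : V -> V -> Prop) (x : V) : V -> Prop :=
| star_refl : star Q x x
| star_step y z : star Q x y -> Q y z -> star Q x z.

Lemma star_trans (V : Type) (Q : V -> V -> Prop) x y z :
  star Q x y -> star Q y z -> star Q x z.
Proof. by move=> xy; elim=> [//|u v _ xu uv]; apply: star_step xu uv. Qed.

Lemma star_sym (V : Type) (Q : V -> V -> Prop) x y :
  (forall u v, Q u v -> Q v u) -> star Q x y -> star Q y x.
Proof.
move=> Qsym; elim=> [|u v _ ux /Qsym uv]; first exact: star_refl.
apply: star_trans ux; apply: star_step uv; exact: star_refl.
Qed.

Lemma star_map (V W : Type) (Q : V -> V -> Prop) (Q' : W -> W -> Prop)
    (f : V -> W) (A : set V) :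
  (forall x y, A x -> Q x y -> A y /\ Q' (f x) (f y)) ->
  forall x y, A x -> star Q x y -> A y /\ star Q' (f x) (f y).
Proof.
move=> AQ x y Ax; elim=> [|u v _ [Au fu] Quv]; first by split=> //; exact: star_refl.
by have [Av fuv] := AQ _ _ Au Quv; split=> //; apply: star_step fu fuv.
Qed.

Section Reach.
Context {V : Type}.
Implicit Types (t : V -> V -> Prop) (S C : set V).

(** Walks of exactly [n] steps inside [S]; once [t] is reflexive, this encodes distance at most [n]
    in the graph induced on [S]. *)
Fixpoint reach t S (n : nat) (x y : V) : Prop :=
  if n is m.+1 then exists z, [/\ reach t S m x z, S y & t z y]
  else S x /\ x = y.

Lemma reach_in t S n x y : reach t S n x y -> S x /\ S y.
Proof.
elim: n y => [|n IHn] y /=; first by move=> [Sx <-].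
by move=> [z [/IHn[Sx _] Sy _]].
Qed.

Lemma reachW t t' S S' n x y : (forall u v, S u -> S v -> t u v -> t' u v) ->
  S `<=` S' -> reach t S n x y -> reach t' S' n x y.
Proof.
move=> tt' SS'; elim: n y => [|n IHn] y /=; first by move=> [/SS'].
move=> [z [xz Sy zy]]; have [_ Sz] := reach_in xz.
by exists z; split; [exact: IHn|exact: SS'|exact: tt'].
Qed.

Lemma reach_trans t S n m x y z :
  reach t S n x y -> reach t S m y z -> reach t S (n + m) x z.
Proof.
move=> xy; elim: m z => [|m IHm] z /=; first by rewrite addn0 => -[_ <-].
by move=> [w [/IHm yw Sz wz]]; rewrite addnS; exists w.
Qed.

Lemma reach_stay_or_exit t S C n x y : reach t S n x y -> C x ->
  reach t C n x y \/
  exists u v, [/\ exists2 k, (k < n)%N & reach t S k x u, C u, S v, ~ C v & t u v].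
Proof.
move=> + Cx; elim: n y => [|n IHn] y /=; first by move=> [_ <-]; left.
move=> [z [xz Sy zy]]; have [xCz|[u [v [[k kn xu] ? ? ? ?]]]] := IHn _ xz.
  have [Cy|nCy] := pselect (C y); first by left; exists z.
  right; exists z, y; split=> //; first by exists n.
  by case: (reach_in xCz).
by right; exists u, v; split=> //; exists k => //; lia.
Qed.

Section Reflexive.
Variable t : V -> V -> Prop.
Hypotheses (t_refl : forall x, t x x) (t_sym : forall x y, t x y -> t y x).

Lemma reach_le S n m x y : (n <= m)%N -> reach t S n x y -> reach t S m x y.
Proof.
move=> /subnK <- ; elim: (m - n)%N => [|k IHk] // /IHk xy.
rewrite addSn; exists y; split=> //.
by case: (reach_in xy).
Qed.

Lemma reach0 S n x : S x -> reach t S n x x.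
Proof. by move=> Sx; apply: (@reach_le _ 0). Qed.

Lemma reach1 S x y : S x -> S y -> t x y -> reach t S 1 x y.
Proof. by move=> Sx Sy xy; exists x. Qed.

Lemma reach_sym S n x y : reach t S n x y -> reach t S n y x.
Proof.
elim: n y => [|n IHn] y /=; first by move=> [? <-].
move=> [z [xz Sy zy]]; have [_ Sz] := reach_in xz.
have := reach_trans (reach1 Sy Sz (t_sym zy)) (IHn _ xz).
by rewrite add1n.
Qed.

Lemma reach_le_trans S n m k x y z : reach t S n x y -> reach t S m y z ->
  (n + m <= k)%N -> reach t S k x z.
Proof. by move=> xy yz nmk; apply: reach_le nmk _; apply: reach_trans yz. Qed.

Lemma reach_exit S C n x y : reach t S n x y -> C x -> ~ C y ->
  exists u v, [/\ reach t S n x u /\ reach t S n x v, C u, S v, ~ C v & t u v].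
Proof.
move=> xy Cx nCy.
have [xCy|[u [v [[k kn xu] ? ? ? ?]]]] := reach_stay_or_exit xy Cx.
  by case: (reach_in xCy).
exists u, v; split=> //; split; first by apply: reach_le xu; lia.
by apply: (@reach_le _ k.+1) => //; exists u.
Qed.

Lemma reach_stay S C n x y : reach t S n x y -> C x ->
  (forall u v, reach t S n x u -> C u -> S v -> ~ C v -> ~ t u v) ->
  reach t C n x y.
Proof.
move=> xy Cx CS; have [//|[u [v [[k kn xu] Cu Sv Cv uv]]]] := reach_stay_or_exit xy Cx.
by case: (CS u v) => //; apply: reach_le xu; lia.
Qed.

End Reflexive.

(** Chain points lie in [C] but jumps are measured in [S], so that chains of a piece can be followed
    in the ambient graph. *)
Definition mono_step {K : Type} t S C (r : nat) (chi : V -> K) (x y : V) : Prop :=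
  [/\ C x, C y, chi x = chi y & reach t S r x y].

Definition bounded_coloring {K : Type} t S (r b : nat) (chi : V -> K) : Prop :=
  forall x y, S x -> star (mono_step t S S r chi) x y -> reach t S b x y.

End Reach.

(** * The hole order and its maximal members *)

Section Nesting.
Variables (V : Type) (t lt : V -> V -> Prop).
Hypotheses (t_refl : forall x, t x x) (t_sym : forall x y, t x y -> t y x).
Hypothesis lt_trans : forall x y z, lt x y -> lt y z -> lt x z.
Hypothesis lt_apart : forall x y, lt x y -> ~ t x y.
Hypothesis lt_absorb : forall x y z, t x z -> lt x y -> t z y \/ lt z y.

Definition touch_or_nested x y := [\/ t x y, lt x y | lt y x].

Hypothesis lt_upper : forall x y z, lt x y -> lt x z -> touch_or_nested y z.

Implicit Types C M S : set V.

Definition maximal C : set V := [set x | C x /\ forall y, C y -> ~ lt x y].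

Lemma lt_irr x : ~ lt x x.
Proof. by move=> /lt_apart; apply. Qed.

Lemma touch_or_nested_refl x : touch_or_nested x x.
Proof. by constructor 1. Qed.

Lemma touch_or_nested_sym x y : touch_or_nested x y -> touch_or_nested y x.
Proof. by move=> [/t_sym xy|xy|xy]; [constructor 1|constructor 3|constructor 2]. Qed.

(** A height witnessing that ascents stop, as they do in finite families; a bound on it also drives
    the recursion on pieces. *)
Definition ranked C (h : V -> nat) : Prop :=
  forall x y, C x -> C y -> lt x y -> (h y < h x)%N.

Lemma maximal_above C h x : ranked C h -> C x ->
  exists2 m, maximal C m & x = m \/ lt x m.
Proof.
move=> hC; have [n] := ubnP (h x); elim: n x => // n IHn x hx Cx.
have [maxx|nmaxx] := pselect (maximal C x); first by exists x => //; left.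
have [y Cy xy] : exists2 y, C y & lt x y.
  by apply: contra_notP nmaxx => nexy; split=> // y Cy xy; apply: nexy; exists y.
have [m Mm ym] := IHn y (leq_trans (hC _ _ Cx Cy xy) hx) Cy.
exists m => //; right; case: ym => [<- //|]; exact: lt_trans.
Qed.

(* Enlarging a nested set does not lose any neighbour, so sending every member
   to a maximal member above it does not increase distances. *)
Lemma touch_or_nested_dominated x y u :
  x = y \/ lt x y -> touch_or_nested x u -> touch_or_nested y u.
Proof.
move=> [<- //|xy] [xu|xu|ux].
- by have [/t_sym|] := lt_absorb xu xy; [constructor 1|constructor 3].
- exact: lt_upper xy xu.
- by constructor 3; apply: lt_trans xy.
Qed.

Lemma reach_retract C (rho : V -> V) n x y :
  (forall u, C u -> maximal C (rho u) /\ (u = rho u \/ lt u (rho u))) ->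
  reach touch_or_nested C n x y -> reach t (maximal C) n (rho x) (rho y).
Proof.
move=> rhoP; elim: n y => [|n IHn] y /=; first by move=> [/rhoP[Mx _] <-].
move=> [z [xz Cy zy]]; have [_ Cz] := reach_in xz; exists (rho z).
have [[Mrz zr] [Mry yr]] := (rhoP _ Cz, rhoP _ Cy); split=> //; first exact: IHn.
(* Both ends are replaced in turn; maximal members cannot be nested, so they touch. *)
have := touch_or_nested_dominated zr zy.
move=> /touch_or_nested_sym/(touch_or_nested_dominated yr)[/t_sym//| |].
- by move=> yz; case: (proj2 Mry (rho z) (proj1 Mrz)).
- by move=> yz; case: (proj2 Mrz (rho y) (proj1 Mry)).
Qed.

Lemma retraction_exists C h : ranked C h ->
  exists rho : V -> V,
    forall u, C u -> maximal C (rho u) /\ (u = rho u \/ lt u (rho u)).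
Proof.
move=> hC; suff /choice[rho rhoP] : forall u, exists m,
    C u -> maximal C m /\ (u = m \/ lt u m) by exists rho.
move=> u; have [Cu|nCu] := pselect (C u); last by exists u.
by have [m Mm um] := maximal_above hC Cu; exists m.
Qed.

(** The retraction fixes maximal members, so these form an isometric antichain. *)
Lemma reach_maximal C h n x y : ranked C h -> maximal C x -> maximal C y ->
  reach t C n x y -> reach t (maximal C) n x y.
Proof.
move=> /retraction_exists[rho rhoP] Mx My xy.
have fix_rho u : maximal C u -> rho u = u.
  move=> [Cu maxu]; have [[Cr _] [//|ur]] := rhoP _ Cu.
  by case: (maxu _ Cr).
rewrite -(fix_rho _ Mx) -(fix_rho _ My); apply: reach_retract rhoP _.
by apply: reachW xy => // u v _ _ uv; constructor 1.
Qed.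

(** Chains project along [rho] to chains of maximal members; the two extra steps join the ends to
    their images. *)
Lemma bounded_coloring_nested (K : Type) C r b (c : V -> K) (rho : V -> V) :
  (forall u, C u -> maximal C (rho u) /\ (u = rho u \/ lt u (rho u))) ->
  bounded_coloring t (maximal C) r b c ->
  bounded_coloring touch_or_nested C r b.+2 (c \o rho).
Proof.
move=> rhoP cb x y Cx xy.
have [Mrx xr] := rhoP _ Cx.
have [Cy rxyM] : C y /\
    star (mono_step t (maximal C) (maximal C) r c) (rho x) (rho y).
  apply: star_map Cx xy => u v Cu [_ Cv cuv uv]; split=> //.
  by split=> //; [case: (rhoP _ Cu)|case: (rhoP _ Cv)|apply: reach_retract uv].
have rxy := cb _ _ Mrx rxyM; have [Mry yr] := rhoP _ Cy.
have up u : C u -> reach touch_or_nested C 1 u (rho u).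
  move=> Cu; have [[Cr _] ur] := rhoP _ Cu; apply: reach1 => //.
  by case: ur => [<-|ur]; [exact: touch_or_nested_refl|constructor 2].
have rxy' : reach touch_or_nested C b (rho x) (rho y).
  by apply: reachW rxy => [u v _ _ uv|u []//]; constructor 1.
have := reach_trans (reach_trans (up _ Cx) rxy')
  (reach_sym touch_or_nested_sym (up _ Cy)).
by rewrite addn1 add1n.
Qed.

Lemma bounded_coloring_antichain (K : Type) M r b (c : V -> K) :
  (forall x y, M x -> M y -> ~ lt x y) ->
  bounded_coloring touch_or_nested M r b c -> bounded_coloring t M r b c.
Proof.
move=> Mlt cb x y Mx xy; apply: (reachW (t := touch_or_nested) (S := M)) => //.
  by move=> u v Mu Mv [//|/(Mlt _ _ Mu Mv)|/(Mlt _ _ Mv Mu)].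
apply: cb => //.
apply: (proj2 (star_map (f := id) (A := setT) _ _ xy)) => // u v _ [Mu Mv cuv uv].
by split=> //; split=> //; apply: reachW uv => // p q _ _ pq; constructor 1.
Qed.

(** * The recursive colouring with collars *)

Section Layers.
Variables (D : set V) (K : Type) (other : K -> K).
Hypothesis other_neq : forall k, other k <> k.
Variables r b0 : nat.
Hypothesis base : forall M, M `<=` D -> (forall x y, M x -> M y -> ~ lt x y) ->
  exists c : V -> K, bounded_coloring t M (3 * r + 6) b0 c.

Definition near n x y := reach t D n x y.

(* The contacts of a child with the outside lie within 3 of its root [y], so
   every [r]-jump into a child lands within [r + 3] of [y]. *)
Definition chain_bound : nat := b0 + 2 * (r + 3).
(** How far from [z] a chain gets after its last visit to the ball of radius [3 * r + 12]: that
    radius, one jump, then a far chain. *)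
Definition radius_bound : nat := chain_bound + r + (3 * r + 12).

(** For an attached [C], contacts with the outside lie within [2 * r + 9] of [z], so from a point
    beyond [3 * r + 12] no walk of length [r + 3] leaves [C]. *)
Definition far_step z (U : set V) (chi : V -> K) (x y : V) : Prop :=
  [/\ mono_step t D U r chi x y, ~ near (3 * r + 12) z x
    & ~ near (3 * r + 12) z y].

(* [z] is a point around which the colour [i] has already been prescribed up to
   distance [r + 3], and forbidden in the next annulus of width [r]; [U] is the
   part of [C] that monochromatic chains coming from outside [C] may enter. *)
Record layered C (z : V) (i : K) (chi : V -> K) (U : set V) : Prop := Layered {
  lay_sub : U `<=` C;
  lay_ball : forall x, C x -> ~ C z -> near (r + 3) z x -> chi x = i;
  lay_annulus : forall x, C x -> ~ C z -> near (r + 3 + r) z x -> chi x = i ->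
    near (r + 3) z x;
  lay_entry : forall x y, C x -> D y -> ~ C y -> near r x y -> U x;
  lay_closed : forall x y, U x -> C y -> chi x = chi y -> near r x y -> U y;
  lay_top : forall x y, U x -> star (far_step z U chi) x y -> near chain_bound x y;
  lay_rest : forall x y, C x -> ~ U x -> star (mono_step t D C r chi) x y ->
    near (2 * radius_bound) x y }.

(* [att_up] keeps the contacts of [C] within 3 of its root at every depth of the
   recursion; without it these distances would add up along the tree. *)
Record attached C (z : V) : Prop := Attached {
  att_sub : C `<=` D;
  att_root : D z;
  att_near : forall u q, C u -> D q -> ~ C q -> t u q -> near (2 * r + 9) z u;
  att_up : forall u v q, C u -> D q -> ~ C q -> t u q -> C v -> lt u v -> t q v }.

Lemma near_sym n x y : near n x y -> near n y x.
Proof. exact: reach_sym. Qed.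

Lemma near_le n m x y : (n <= m)%N -> near n x y -> near m x y.
Proof. exact: reach_le. Qed.

Lemma near_trans n m k x y z : near n x y -> near m y z -> (n + m <= k)%N ->
  near k x z.
Proof. exact: reach_le_trans. Qed.

Lemma near_touch x y : D x -> D y -> t x y -> near 1 x y.
Proof. exact: reach1. Qed.

(** By [lay_closed], a chain starting in [U] stays there. Either all its steps are far, or its end
    is within [radius_bound] of [z]; reversing the chain gives the same alternative for its
    start. *)
Lemma layered_bounded C z i chi U : C `<=` D -> layered C z i chi U ->
  forall x y, C x -> star (mono_step t D C r chi) x y -> near (2 * radius_bound) x y.
Proof.
move=> CD L x y Cx xy; have [Ux|nUx] := pselect (U x); last exact: (lay_rest L Cx).
have [Uy xyU] : U y /\ star (mono_step t D U r chi) x y.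
  apply: (star_map (f := id)) Ux xy => u v Uu [Cu Cv cuv uv].
  by have Uv := lay_closed L Uu Cv cuv uv.
have DU : U `<=` D by move=> u /(lay_sub L)/CD.
have chain u v : U u -> star (mono_step t D U r chi) u v ->
    star (far_step z U chi) u v \/ near radius_bound z v.
  move=> Uu uv.
  have [|[zv|[w [zw wv Uw]]]] : star (far_step z U chi) u v \/ (near (3 * r + 12) z v \/
      exists w, [/\ near (r + (3 * r + 12)) z w, star (far_step z U chi) w v & U w]).
  - elim: uv => [|p q _ IH pq]; first by left; exact: star_refl.
    have [zq|nzq] := pselect (near (3 * r + 12) z q); first by right; left.
    have [zp|nzp] := pselect (near (3 * r + 12) z p).
      right; right; exists q; case: (pq) => Up Uq _ npq; split=> //; last exact: star_refl.
      by apply: near_trans zp npq _; lia.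
    case: IH => [up|[//|[w0 [zw0 w0p Uw0]]]]; first by left; apply: star_step up _.
    by right; right; exists w0; split=> //; apply: star_step w0p _.
  - by left.
  - by right; apply: near_le zv; rewrite /radius_bound; lia.
  - right; apply: near_trans zw (lay_top L Uw wv) _; rewrite /radius_bound; lia.
have top u v : star (far_step z U chi) u v -> U u -> near (2 * radius_bound) u v.
  move=> uv Uu; apply: near_le (lay_top L Uu uv); rewrite /radius_bound; lia.
have [/top|zy] := chain _ _ Ux xyU; first exact.
have yxU : star (mono_step t D U r chi) y x.
  by apply: star_sym xyU => u v [? ? ? uv]; split=> //; exact: near_sym.
have [/top/(_ Uy)/near_sym//|zx] := chain _ _ Uy yxU.
by apply: near_trans (near_sym zx) zy _; lia.
Qed.

(** The piece [P] is what touches a maximal member; the rest is divided into children below maximal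
    members. Children rooted near [z] continue the prescription at [z], the others start a new one
    at their own root. *)
Lemma layered_exists n h C z i : attached C z -> ranked C h ->
  (forall x, C x -> (h x < n)%N) -> exists chi U, layered C z i chi U.
Proof.
elim: n h C z i => [|n IHn] h C z i Catt hC hn.
  have C0 x : ~ C x by move=> /hn.
  exists (fun=> i), set0; split=> [x []|x Cx|x Cx|x y Cx|x y []|x y []|x y Cx];
    by case: (C0 x).
have [CD Dz Cnear Cup] := Catt.
(* [pick] sees only the set [above x], so touching members outside [P], which have the same sets
   above them, get the same [top]. *)
have [pick pickP] : exists pick : set V -> V, forall Y, Y !=set0 -> Y (pick Y).
  suff /choice[pick pickP] : forall Y : set V, exists y, Y !=set0 -> Y y by exists pick.
  by move=> Y; have [[y Yy]|] := pselect (Y !=set0); [exists y|exists z].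
pose M := maximal C; pose P := [set x | C x /\ exists2 m, M m & t x m].
pose above x := [set m | M m /\ lt x m]; pose top x := pick (above x).
pose child y := [set x | [/\ C x, ~ P x & top x = y]].
have MC m : M m -> C m by case.
have MP m : M m -> P m by move=> Mm; split; [exact: MC|exists m].
have topP x : C x -> ~ P x -> above x (top x).
  move=> Cx nPx; apply: pickP; have [m Mm [xm|xm]] := maximal_above hC Cx.
    by case: nPx; apply: MP; rewrite xm.
  by exists m.
have [mm mmP] : exists mm : V -> V, forall x, P x -> M (mm x) /\ t x (mm x).
  suff /choice[mm mmP] : forall x, exists m, P x -> M m /\ t x m by exists mm.
  by move=> x; have [[_ [m Mm xm]]|] := pselect (P x); [exists m|exists x].
have above_sub u v : t u v -> C v -> ~ P v -> above u `<=` above v.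
  move=> uv Cv nPv m [Mm um]; split=> //; have [vm|//] := lt_absorb uv um.
  by case: nPv; split=> //; exists m.
have top_touch u v : C u -> ~ P u -> C v -> ~ P v -> t u v -> top u = top v.
  move=> Cu nPu Cv nPv uv; congr pick; apply/seteqP; split; first exact: above_sub.
  by apply: above_sub => //; exact: t_sym.
have childC y : child y `<=` C by move=> x [].
have childP x : C x -> ~ P x -> child (top x) x by [].
have child_lt y x : child y x -> M y /\ lt x y.
  by move=> [Cx nPx <-]; exact: topP.
have below_nonmax q v : P q -> lt q v -> C v -> t (mm q) v.
  move=> Pq qv Cv; have [[Cm maxm] qm] := mmP _ Pq.
  by have [//|/(maxm _ Cv)] := lt_absorb qm qv.
have outP y u q : child y u -> C q -> ~ child y q -> t u q -> P q.
  move=> [Cu nPu <-] Cq nq uq; apply: contra_notP nq => nPq.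
  by split=> //; rewrite (top_touch q u) //; exact: t_sym.
(* The 3 is one step from [u] to [q] and at most two from [q] to [y], through [mm q] if [q] lies
   below [y]. *)
have child_near y u q : child y u -> D q -> ~ child y q -> t u q -> near 3 y u.
  move=> yu Dq nyq uq; have [My uy] := child_lt _ _ yu.
  have [Dy Du] : D y /\ D u by split; apply: CD; [exact: MC|exact: childC yu].
  have uq1 : near 1 q u by apply: near_touch => //; exact: t_sym.
  suff yq : near 2 y q by exact: near_trans yq uq1 _.
  have qy1 : t q y -> near 2 y q.
    by move=> /t_sym qy; apply: near_le (near_touch Dy Dq qy).
  have [Cq|nCq] := pselect (C q); last first.
    by apply: qy1; apply: (Cup u) => //; [exact: childC yu|exact: MC].
  have Pq := outP _ _ _ yu Cq nyq uq.
  have [|qy] := lt_absorb uq uy; first exact: qy1.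
  have [Mm qm] := mmP _ Pq; have my := below_nonmax _ _ Pq qy (MC _ My).
  have Dm := CD _ (MC _ Mm).
  have m1 : near 1 y (mm q) by apply: near_touch => //; exact: t_sym.
  by apply: near_trans m1 (near_touch _ _ (t_sym qm)) _.
have child_up y u v q : child y u -> D q -> ~ child y q -> t u q -> child y v ->
    lt u v -> t q v.
  move=> yu Dq nyq uq yv uv; have Cv := childC _ _ yv.
  have [Cq|nCq] := pselect (C q); last by apply: (Cup u) => //; exact: childC yu.
  have Pq := outP _ _ _ yu Cq nyq uq; have [//|qv] := lt_absorb uq uv.
  have [_ nPv _] := yv; case: nPv; split=> //; exists (mm q).
    by case: (mmP _ Pq).
  by apply: t_sym; exact: below_nonmax.
have [c cP] : exists c : V -> K, bounded_coloring t M (3 * r + 6) b0 c.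
  by apply: base => [x /MC/CD//|x y [_ maxx] /MC]; exact: maxx.
(* The annulus has outer radius [2 * r + 3]; with 3 more, a child whose root is farther does not
   meet it ([child_far]). The 3 of [child_near] then gives the [2 * r + 9] of [att_near], at every
   depth. *)
pose N y := near (2 * r + 6) z y.
pose zc y := if pselect (N y) then z else y.
pose ic y := if pselect (N y) then i else c y.
have nchildM y m : M m -> ~ child y m by move=> /MP Pm [].
have child_att y : M y -> attached (child y) (zc y).
  move=> My; have Dy := CD _ (MC _ My); rewrite /zc.
  split; [by move=> x /childC/CD|by case: pselect| |exact: child_up].
  move=> u q yu Dq nyq uq; have yu3 := child_near _ _ _ yu Dq nyq uq.
  by case: pselect => [Ny|nNy] /=;
    [apply: near_trans Ny yu3 _; lia|apply: near_le yu3; lia].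
(* Members of a child lie below its root, so their ranks are positive and stay strictly ordered
   after [predn]. *)
have child_rank y : ranked (child y) (predn \o h).
  move=> u v yu yv uv /=; have Cv := childC _ _ yv.
  have [My vy] := child_lt _ _ yv.
  have := hC _ _ (childC _ _ yu) Cv uv; have := hC _ _ Cv (MC _ My) vy; lia.
have child_bound y x : child y x -> ((predn \o h) x < n)%N.
  move=> yx /=; have [My xy] := child_lt _ _ yx.
  have := hC _ _ (childC _ _ yx) (MC _ My) xy; have := hn _ (childC _ _ yx); lia.
have [f fP] : exists f : V -> (V -> K) * set V,
    forall y, M y -> layered (child y) (zc y) (ic y) (f y).1 (f y).2.
  suff /choice[f fP] : forall y, exists p : (V -> K) * set V,
    M y -> layered (child y) (zc y) (ic y) p.1 p.2 by exists f.
  move=> y; have [My|nMy] := pselect (M y); last by exists (fun=> i, set0).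
  have [chi [U L]] := IHn _ _ _ (ic y) (child_att _ My) (child_rank y) (@child_bound y).
  by exists (chi, U).
(* On [P]: colour [i] in the prescribed ball, another colour on the collar out to [2 * r + 6], then
   the colour of a touching maximal member. *)
pose chi x := if pselect (P x) then
    if pselect (near (r + 3) z x) then i
    else if pselect (N x) then other i else c (mm x)
  else (f (top x)).1 x.
(* Chains from outside may run through [P] and the entry parts of children rooted near [z]; into
   other children they get no deeper than the ball around the root. *)
pose U x := C x /\ (~ P x ->
  if pselect (N (top x)) then (f (top x)).2 x else near (r + 3) (top x) x).
have chi_child y x : child y x -> chi x = (f y).1 x.
  by move=> [Cx nPx <-]; rewrite /chi; case: pselect.
have U_P x : P x -> U x by move=> Px; split=> //; case: Px.
have U_in y x : child y x -> N y -> U x <-> (f y).2 x.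
  move=> [Cx nPx topx] Ny; rewrite /U topx; case: pselect => //= _.
  by split=> [[_]|]; [apply|].
have U_out y x : child y x -> ~ N y -> U x <-> near (r + 3) y x.
  move=> [Cx nPx topx] Ny; rewrite /U topx; case: pselect => //= _.
  by split=> [[_]|]; [apply|].
have layN y : M y -> N y -> layered (child y) z i (f y).1 (f y).2.
  by move=> /fP + Ny; rewrite /zc /ic; case: pselect.
have layF y : M y -> ~ N y -> layered (child y) y (c y) (f y).1 (f y).2.
  by move=> /fP + Ny; rewrite /zc /ic; case: pselect.
have child_border y x q : child y x -> D q -> ~ child y q -> near r x q ->
    near (r + 3) y x.
  move=> yx Dq nyq xq; have [u [v [[xu _] yu Dv nyv uv]]] := reach_exit t_refl xq yx nyq.
  by apply: near_trans (child_near _ _ _ yu Dv nyv uv) (near_sym xu) _; lia.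
have child_far y x : child y x -> ~ N y -> ~ C z -> ~ near (r + 3 + r) z x.
  move=> yx nNy nCz zx; apply: nNy.
  have nyz : ~ (~` child y) x by apply.
  have nyCz : (~` child y) z by move=> /childC.
  have [v [u [[zv zu] nyv Du nnyu vu]]] := reach_exit t_refl zx nyCz nyz.
  have yu : child y u by apply: contrapT.
  have [_ Dv] := reach_in zv.
  have yu3 := child_near _ _ _ yu Dv nyv (t_sym vu).
  by apply: near_trans zu (near_sym yu3) _; lia.
have child_entry y x q : child y x -> D q -> ~ child y q -> near r x q -> U x.
  move=> yx Dq nyq xq; have [My _] := child_lt _ _ yx.
  have [Ny|nNy] := pselect (N y).
    by apply/(U_in _ _ yx Ny); exact (lay_entry (layN _ My Ny) yx Dq nyq xq).
  by apply/(U_out _ _ yx nNy); exact: child_border yx Dq nyq xq.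
have entry x y : C x -> D y -> ~ C y -> near r x y -> U x.
  move=> Cx Dy nCy xy; have [/U_P//|nPx] := pselect (P x).
  have nyy : ~ child (top x) y by move=> /childC.
  exact: child_entry (childP _ Cx nPx) Dy nyy xy.
have closed x y : U x -> C y -> chi x = chi y -> near r x y -> U y.
  move=> Ux Cy cxy xy; have [/U_P//|nPy] := pselect (P y).
  have Dx : D x by case: Ux => /CD.
  have ty := childP _ Cy nPy; have [Mt _] := child_lt _ _ ty.
  have [tx|ntx] := pselect (child (top y) x); last first.
    exact: child_entry ty Dx ntx (near_sym xy).
  move: cxy; rewrite (chi_child _ _ tx) (chi_child _ _ ty) => cxy.
  have [Nt|nNt] := pselect (N (top y)).
    move/(U_in _ _ tx Nt): Ux => Ux; apply/(U_in _ _ ty Nt).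
    exact (lay_closed (layN _ Mt Nt) Ux ty cxy xy).
  (* [x] is in the ball around the root and has its colour, which the annulus avoids; so [y], at
     most [r] further, is in the ball too. *)
  have L := layF _ Mt nNt; have ntt := nchildM (top y) _ Mt.
  move/(U_out _ _ tx nNt): Ux => Ux; apply/(U_out _ _ ty nNt).
  apply: (lay_annulus L ty ntt); first by apply: near_trans Ux xy _.
  by rewrite -cxy; exact: (lay_ball L tx ntt Ux).
exists chi, U; split=> //.
- by move=> x [].
- move=> x Cx nCz zx; have [Px|nPx] := pselect (P x).
    by rewrite /chi; case: pselect => //= _; case: pselect.
  have yx := childP _ Cx nPx; have [My _] := child_lt _ _ yx.
  have [Ny|nNy] := pselect (N (top x)); last first.
    by case: (child_far _ _ yx nNy nCz); apply: near_le zx; lia.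
  rewrite (chi_child _ _ yx); apply: lay_ball (layN _ My Ny) _ yx _ zx.
  by move=> /childC.
- move=> x Cx nCz zx; have [Px|nPx] := pselect (P x).
    rewrite /chi; case: pselect => //= _; case: pselect => //= _.
    case: pselect => [_ /other_neq//|nNx].
    by case: nNx; apply: near_le zx; lia.
  have yx := childP _ Cx nPx; have [My _] := child_lt _ _ yx.
  have [Ny|nNy] := pselect (N (top x)); last by case: (child_far _ _ yx nNy nCz).
  rewrite (chi_child _ _ yx); refine (lay_annulus (layN _ My Ny) yx _ zx).
  by move=> /childC.
- move=> x y Ux xy; have Cx : C x by case: Ux.
  (* A child rooted near [z] has its contacts near [z], so a far chain cannot leave it and the
     induction bound carries over unchanged. *)
  have chain_child u v w : child w u -> N w -> far_step z U chi u v ->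
      child w v /\ far_step z (f w).2 (f w).1 u v.
    move=> wu Nw [[Uu Uv cuv uv] nzu nzv]; have Cv : C v by case: Uv.
    have Mw : M w by case: (child_lt _ _ wu).
    have wv : child w v.
      apply: contrapT => nwv.
      have [p [q [[up _] wp Dq nwq pq]]] := reach_exit t_refl uv wu nwv.
      have zp := att_near (child_att _ Mw) wp Dq nwq pq.
      move: zp; rewrite /zc; case: pselect => //= _ zp.
      by apply: nzu; apply: near_trans zp (near_sym up) _; lia.
    split=> //; split=> //; split=> //; [exact/(U_in _ _ wu Nw)|exact/(U_in _ _ wv Nw)|].
    by rewrite -!chi_child.
  have [[w wx Nw]|nNx] := pselect (exists2 w, child w x & N w).
    have Mw : M w by case: (child_lt _ _ wx).
    have [wy xyw] : child w y /\ star (far_step z (f w).2 (f w).1) x y.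
      by apply: (star_map (f := id)) wx xy => u v wu; exact: chain_child.
    move/(U_in _ _ wx Nw): Ux => Ux; exact (lay_top (layN _ Mw Nw) Ux xyw).
  (* Any other far chain projects, keeping colours, to a chain of maximal members within [r + 3] of
     it. *)
  pose pi u := if pselect (P u) then mm u else top u.
  have piP u : U u -> ~ (exists2 w, child w u & N w) -> ~ near (3 * r + 12) z u ->
      [/\ M (pi u), chi u = c (pi u) & near (r + 3) u (pi u)].
    move=> Uu nNu nzu; have Cu : C u by case: Uu.
    have [Pu|nPu] := pselect (P u).
      have [Mm um] := mmP _ Pu; rewrite /pi /chi; case: pselect => //= _.
      split=> //; last first.
        apply: near_le (near_touch (CD _ Cu) (CD _ (MC _ Mm)) um); lia.
      case: pselect => /= [zu|_]; first by case: nzu; apply: near_le zu; lia.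
      by case: pselect => //= Nu; case: nzu; apply: near_le Nu; lia.
    have tu := childP _ Cu nPu; have [Mt _] := child_lt _ _ tu.
    have nNt : ~ N (top u) by move=> Nt; apply: nNu; exists (top u).
    have ntu : near (r + 3) (top u) u by apply/(U_out _ _ tu nNt).
    have -> : pi u = top u by rewrite /pi; case: pselect.
    split=> //; last exact: near_sym.
    rewrite (chi_child _ _ tu).
    exact (lay_ball (layF _ Mt nNt) tu (nchildM _ _ Mt) ntu).
  have inside u v k : C u -> ~ near (3 * r + 12) z u -> (k <= r + 3)%N ->
      near k u v -> reach t C k u v.
    move=> Cu nzu kr uv; apply: reach_stay uv Cu _ => // p q up Cp Dq nCq pq.
    apply: nzu; apply: near_trans (Cnear _ _ Cp Dq nCq pq) (near_sym up) _; lia.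
  have [zx|nzx] := pselect (near (3 * r + 12) z x).
    have -> : y = x.
      by elim: xy => // u v _ -> [].
    by apply: reach0 => //; exact: CD.
  pose B u := [/\ U u, ~ (exists2 w, child w u & N w) & ~ near (3 * r + 12) z u].
  have [[Uy nNy nzy] xyM] : B y /\ star (mono_step t M M (3 * r + 6) c) (pi x) (pi y).
    have Bx : B x by [].
    apply: star_map Bx xy => u v [Uu nNu nzu] uv; have [[_ Uv cuv nuv] _ nzv] := uv.
    have [Cu Cv] : C u /\ C v by case: Uu; case: Uv.
    have nNv : ~ (exists2 w, child w v & N w).
      move=> [w wv Nw]; apply: nNu; exists w => //.
      apply: (proj1 (chain_child v u w wv Nw _)); split=> //; split=> //.
      exact: near_sym.
    have [Mu cu upi] := piP _ Uu nNu nzu; have [Mv cv vpi] := piP _ Uv nNv nzv.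
    split=> //; split=> //; first by rewrite -cu -cv.
    (* The walk through [u] and [v] stays in [C]; its length [(r + 3) + r + (r + 3)] is the scale
       [3 * r + 6] of [base]. *)
    apply: (reach_maximal hC Mu Mv).
    have upiC := inside _ _ _ Cu nzu (leqnn _) upi.
    have vpiC := inside _ _ _ Cv nzv (leqnn _) vpi.
    have uvC : reach t C r u v by apply: inside nuv => //; lia.
    apply: reach_le_trans (reach_sym t_sym upiC) (reach_trans uvC vpiC) _ => //; lia.
  have [Mx _ xpi] := piP _ Ux nNx nzx; have [_ _ ypi] := piP _ Uy nNy nzy.
  have xyD : near b0 (pi x) (pi y).
    by apply: reachW (cP _ _ Mx xyM) => // u /MC/CD.
  apply: near_trans xpi (reach_trans xyD (near_sym ypi)) _; rewrite /chain_bound; lia.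
- move=> x y Cx nUx xy; have nPx : ~ P x by move=> /U_P.
  have tx := childP _ Cx nPx; have [Mt _] := child_lt _ _ tx.
  (* From a point of a child outside [U], jumps lead only to such points, so the chain stays in one
     child. *)
  pose A u := child (top x) u /\ ~ U u.
  have [_ xyt] : A y /\ star (mono_step t D (child (top x)) r (f (top x)).1) x y.
    apply: (star_map (f := id)) (conj tx nUx) xy => u v [tu nUu] [Cu Cv cuv uv].
    have tv : child (top x) v.
      by apply: contra_notP nUu => ntv; apply: child_entry tu (CD _ Cv) ntv uv.
    split; last by split=> //; rewrite -!(chi_child (top x)).
    split=> // Uv; apply: nUu; exact: closed Uv Cu (esym cuv) (near_sym uv).
  have tD : child (top x) `<=` D by move=> u /childC/CD.
  exact (layered_bounded tD (fP _ Mt) tx xyt).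
Qed.

(** With [C = D] nothing lies outside, so any [z] in [D] serves as attaching point and prescribes
    nothing. *)
Lemma layered_coloring n h (k : K) : ranked D h -> (forall x, D x -> (h x < n)%N) ->
  exists chi : V -> K, bounded_coloring t D r (2 * radius_bound) chi.
Proof.
move=> hD hn; have [[z Dz]|D0] := pselect (D !=set0); last first.
  by exists (fun=> k) => x y Dx; case: D0; exists x.
have attD : attached D z by split.
have [chi [U L]] := layered_exists k attD hD hn.
by exists chi => x y Dx; exact: (layered_bounded (@subset_refl _ D) L Dx).
Qed.

End Layers.
End Nesting.

(** * Compactness: reduction to finite subfamilies *)

Section FiniteSubfamilies.
Context {V : Type}.
Implicit Types (t lt : V -> V -> Prop) (D : set V) (s : seq V).

Definition part D s : set V := [set x | D x /\ List.In x s].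

Lemma count_lt (P Q : pred V) s y : subpred P Q -> List.In y s -> Q y -> ~~ P y ->
  (count P s < count Q s)%N.
Proof.
move=> PQ; elim: s => [//|z s IHs] /= [->|/IHs{}IHs] Qy nPy.
  by rewrite Qy (negbTE nPy) add0n add1n ltnS; exact: sub_count.
by have := IHs Qy nPy; have := PQ z; case: (P z) => [/(_ isT) ->|_] /=; lia.
Qed.

(** Rank [x] by the number of listed members above it; going up loses at least the member
    reached. *)
Lemma part_ranked lt D s :
  (forall x y z, lt x y -> lt y z -> lt x z) -> (forall x, ~ lt x x) ->
  exists h, ranked lt (part D s) h /\ forall x, (h x < (size s).+1)%N.
Proof.
move=> lt_trans lt_irr; exists (fun x => count (fun y => `[< lt x y >]) s).
split=> [x y _ [_ sy] xy|x]; last by rewrite ltnS; exact: count_size.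
apply: (count_lt (y := y)) => //; last first.
- by apply/negP => /asboolP/lt_irr.
- exact/asboolP.
by move=> z /asboolP yz; apply/asboolP; exact: lt_trans yz.
Qed.

Lemma reach_part t D n x y : reach t D n x y ->
  exists s0, forall s, List.incl s0 s -> reach t (part D s) n x y.
Proof.
elim: n y => [|n IHn] y /=.
  by move=> [Dx <-]; exists [:: x] => s s0s; split=> //; split=> //; apply: s0s; left.
move=> [z [/IHn[s0 s0P] Dy zy]]; exists (y :: s0) => s s0s; exists z; split=> //.
  by apply: s0P => w ?; apply: s0s; right.
by split=> //; apply: s0s; left.
Qed.

(* Compactness: a colouring of [D] is extracted, along an ultrafilter, from
   colourings of its finite parts; a bad chain would already be bad in some
   finite part, where distances are only larger. *)
Lemma bounded_coloring_compact t D m r b :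
  (forall s, exists chi : V -> 'I_m.+1, bounded_coloring t (part D s) r b chi) ->
  exists chi : V -> 'I_m.+1, bounded_coloring t D r b chi.
Proof.
move=> /choice[c cP].
pose F : set_system (seq V) := [set A | exists s0, forall s, List.incl s0 s -> A s].
have FF : ProperFilter F.
  split; first by move=> [s0 /(_ s0 (List.incl_refl _))].
  split; first by exists [::].
  - move=> A B [s1 As1] [s2 Bs2]; exists (s1 ++ s2) => s s12.
    split; [apply: As1|apply: Bs2] => x xs; apply: s12; apply/List.in_or_app; tauto.
  - by move=> A B AB [s0 As0]; exists s0 => s /As0/AB.
have [G [GU FG]] := ultraFilterLemma FF.
have GF : ProperFilter G := ultra_proper.
have [chi chiP] : exists chi : V -> 'I_m.+1, forall x, G [set s | c s x = chi x].
  suff /choice[chi chiP] : forall x, exists k, G [set s | c s x = k] by exists chi.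
  move=> x; apply: contrapT => nG.
  have : \forall s \near G, forall k, c s x <> k.
    apply: filter_forall => k.
    have [Gk|//] := in_ultra_setVsetC [set s | c s x = k] GU.
    by case: nG; exists k.
  by move=> /filter_ex[s /(_ (c s x))].
have Greach n x y : reach t D n x y -> G [set s | reach t (part D s) n x y].
  by move=> /reach_part xy; exact: FG.
exists chi => x y Dx xy.
have : G [set s | star (mono_step t (part D s) (part D s) r (c s)) x y].
  elim: xy => [|u v _ IH [Du Dv cuv /Greach uv]].
    by apply: filterS filterT => s _; exact: star_refl.
  apply: filterS (filterI (filterI IH uv) (filterI (chiP u) (chiP v))).
  move=> s [[xu uvs] [cu cv]]; apply: star_step xu _.
  have [us vs] := reach_in uvs; split=> //.
  by rewrite [LHS]cu [RHS]cv.
have Gx : G [set s | part D s x].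
  by apply: FG; exists [:: x] => s sx; split=> //; apply: sx; left.
move=> /(filterI Gx)/filter_ex[s [sx /(cP s _ _ sx)]].
by apply: reachW => // u [].
Qed.

End FiniteSubfamilies.

(** * Asymptotic dimension through colourings *)

Section Asdim.
Context {R : realType} {T I : Type} (F : I -> set T).
Hypothesis F_ne : forall i, F i !=set0.

Definition touch (i j : I) : Prop := F i `&` F j !=set0.

Lemma touch_refl i : touch i i.
Proof. by rewrite /touch setIid. Qed.

Lemma touch_sym i j : touch i j -> touch j i.
Proof. by rewrite /touch setIC. Qed.

Lemma path_reach (D : set I) (x : D) (p : seq D) :
  path (@adj (intersection_graph (subfamily F (D := D)))) x p ->
  reach touch D (size p) (val x) (val (last x p)).
Proof.
elim: p x => [|y p IHp] x /=; first by move=> _; split=> //; exact: set_valP.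
move=> /andP[/asboolP[_ xy] /IHp yp].
have xy1 : reach touch D 1 (val x) (val y) by apply: reach1 => //; exact: set_valP.
by have := reach_trans xy1 yp; rewrite add1n.
Qed.

Lemma reach_path (D : set I) (x : D) n v : reach touch D n (val x) v ->
  exists y : D, val y = v /\
    exists2 p, path (@adj (intersection_graph (subfamily F (D := D)))) x p
      & last x p = y /\ (size p <= n)%N.
Proof.
elim: n v => [|n IHn] v /=; first by move=> [_ <-]; exists x; split=> //; exists [::].
move=> [w [/IHn[z [<- [p xp [pz pn]]]] Dv zv]].
have [e|ne] := pselect (val z = v).
  by exists z; split=> //; exists p => //; split=> //; exact: leqW.
exists (SigSub (mem_set Dv)); split=> //; exists (rcons p (SigSub (mem_set Dv))).
  by rewrite rcons_path xp pz; apply/asboolP; split=> // e; apply: ne; rewrite e.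
by rewrite last_rcons size_rcons.
Qed.

Lemma gdist_gt (D : set I) (x y : D) n : ~ reach touch D n (val x) (val y) ->
  (n.+1%:R%:E <= @gdist R (intersection_graph (subfamily F (D := D))) x y)%E.
Proof.
move=> nxy; apply/ereal_infP => _ [p [xp py _] <-]; rewrite lee_fin ler_nat ltnNge.
apply/negP => pn; apply: nxy; rewrite -py; apply: (reach_le touch_refl pn).
exact: path_reach.
Qed.

Lemma gdist_le (D : set I) (x y : D) n :
  (@gdist R (intersection_graph (subfamily F (D := D))) x y <= n%:R%:E)%E
  <-> reach touch D n (val x) (val y).
Proof.
split=> [xyn|/reach_path[z [/val_inj <- [p xp [pz pn]]]]].
  apply: contrapT => /gdist_gt/le_trans/(_ xyn).
  by rewrite lee_fin ler_nat ltnn.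
move: pz; case: (@shortenP {classic D} _ _ _ xp) => q xq uq qp qz.
have qn : (size q <= n)%N.
  by apply: leq_trans pn; apply: uniq_leq_size qp; case/andP: uq.
apply: (@le_trans _ _ (size q)%:R%:E); last by rewrite lee_fin ler_nat.
by apply: ereal_inf_lbound; exists q.
Qed.

Definition uniform_coloring (t : I -> I -> Prop) (m : nat) : Prop :=
  forall r, (0 < r)%N -> exists b, forall D : set I,
  exists chi : I -> 'I_m.+1, bounded_coloring t D r b chi.

(** From a cover, colour a vertex by the index of a set containing it: [r]-disjointness traps each
    chain in one set. From a colouring, take the chain classes as cover. *)
Lemma asdim_atmostP m :
  asdim_atmost R (fun G => exists D : set I,
    G = intersection_graph (subfamily F (D := D))) m <-> uniform_coloring touch m.
Proof.
split=> [[f fP] r r0|colP].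
  exists (Num.bound (f r%:R%:nng)%:num) => D.
  have [C [Ccov Cdiam Cdisj]] := fP _ (ex_intro _ D erefl) r r0.
  have /choice[p pP] : forall v, exists p : 'I_m.+1 * set D,
      forall x : D, val x = v -> C p.1 p.2 /\ p.2 x.
    move=> v; have [Dv|nDv] := pselect (D v); last first.
      by exists (ord0, set0) => x xv; case: nDv; rewrite -xv; exact: set_valP.
    have [i _ [U iU Ux]] : (\bigcup_i \bigcup_(U in C i) U) (SigSub (mem_set Dv)).
      by rewrite Ccov.
    by exists (i, U) => x xv; have -> : x = SigSub (mem_set Dv) by exact: val_inj.
  exists (fst \o p) => u v Du uv.
  pose x : D := SigSub (mem_set Du).
  have [Dv puv] : D v /\ p v = p u.
    elim: uv => // v' w _ [_ puv] [Dv Dw /= cvw vw]; split=> //.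
    pose y : D := SigSub (mem_set Dv); pose z : D := SigSub (mem_set Dw).
    have [Cy yU] := pP _ y erefl; have [Cz zU] := pP _ z erefl.
    rewrite -puv [p w]surjective_pairing [p v']surjective_pairing -cvw.
    congr pair; apply: contrapT => pwv; rewrite -cvw in Cz.
    have := Cdisj _ _ _ Cy Cz (nesym pwv); apply/negP; rewrite -leNgt.
    apply: (@le_trans _ _ (@gdist R (intersection_graph (subfamily F (D := D))) y z)).
      by apply: ereal_inf_lbound; exists (y, z).
    exact/gdist_le.
  pose y : D := SigSub (mem_set Dv).
  have [Cx xU] := pP _ x erefl; have [_ yU] := pP _ y erefl.
  apply/(gdist_le x y).
  apply: (@le_trans _ _ (f r%:R%:nng)%:num%:E); last first.
    by rewrite lee_fin ltW// archi_boundP.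
  apply: le_trans (Cdiam _ _ Cx); apply: ereal_sup_ubound; exists (x, y) => //.
  by split=> //=; rewrite -[X in X.2]puv.
have /choice[b bP] : forall r, exists b, (0 < r)%N -> forall D : set I,
    exists chi : I -> 'I_m.+1, bounded_coloring touch D r b chi.
  by move=> r; have [/colP[b bP]|r0] := pselect (0 < r)%N; [exists b|exists 0%N].
(* Control functions take real arguments, so [b] is extended by truncation, which is exact at
   integers. *)
exists (fun x => (b (Num.trunc x%:num))%:R%:nng) => G [D ->] r r0.
have [chi chiP] := bP _ r0 D.
pose step := mono_step touch D D r chi.
pose cls (x : D) : set D := [set y | star step (val x) (val y)].
have step_sym u v : step u v -> step v u.
  by move=> [Du Dv uv /(reach_sym touch_sym)]; split.
have same_color u v : star step u v -> chi v = chi u.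
  by elim=> // v' w _ <- [].
exists (fun i => [set U | exists2 x : D, chi (val x) = i & U = cls x]); split.
- apply/seteqP; split=> // x _; exists (chi (val x)) => //; exists (cls x).
    by exists x.
  exact: star_refl.
- move=> i _ [x _ ->]; apply: ge_ereal_sup => _ [[y z] [/= xy xz] <-].
  rewrite /= natrK; apply/gdist_le; apply: chiP; first exact: set_valP.
  by apply: star_trans xz; apply: star_sym step_sym xy.
- move=> i _ _ [x xi ->] [y yi ->] xy.
  (* Distances are integers or infinite, so exceeding [r] means being at least [r.+1], a bound that
     survives the infimum. *)
  apply: (@lt_le_trans _ _ r.+1%:R%:E); first by rewrite lte_fin ltr_nat.
  apply/ereal_infP => _ [[u v] [/= xu yv] <-]; apply: gdist_gt => uv.
  have cuv : chi (val u) = chi (val v).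
    by rewrite (same_color _ _ xu) (same_color _ _ yv) xi yi.
  have xy' : star step (val x) (val y).
    apply: star_trans (star_sym step_sym yv); apply: star_step xu _.
    by split=> //; exact: set_valP.
  apply: xy; apply/seteqP; split=> z xz; first exact: star_trans (star_sym step_sym xy') xz.
  exact: star_trans xy' xz.
Qed.

End Asdim.

(** * Transport along a bijection of indices *)

Section Bijection.
Variables (I J : Type) (f : I -> J) (g : J -> I).
Hypotheses (fK : cancel f g) (gK : cancel g f).

Lemma uniform_coloring_pull (t : J -> J -> Prop) m :
  uniform_coloring t m -> uniform_coloring (fun i j => t (f i) (f j)) m.
Proof.
move=> col r /col[b bP]; exists b => D; have [chi chiP] := bP (g @^-1` D).
exists (chi \o f).
have push n x y : reach (fun i j => t (f i) (f j)) D n x y ->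
    reach t (g @^-1` D) n (f x) (f y).
  elim: n y => [|n IHn] y /=; first by move=> [Dx <-]; rewrite fK.
  by move=> [z [/IHn xz Dy zy]]; exists (f z); rewrite /preimage /= fK.
have pull n x y : reach t (g @^-1` D) n x y ->
    reach (fun i j => t (f i) (f j)) D n (g x) (g y).
  elim: n y => [|n IHn] y /=; first by move=> [Dx <-].
  by move=> [z [/IHn xz Dy zy]]; exists (g z); rewrite !gK.
move=> x y Dx xy; rewrite -(fK x) -(fK y); apply: pull; apply: chiP.
  by rewrite /preimage /= fK.
apply: (proj2 (star_map (f := f) (A := setT) _ _ xy)) => // u v _.
by move=> [Du Dv cuv /push uv]; split=> //; split=> //; rewrite /preimage /= fK.
Qed.

End Bijection.

(** * Connected sets and their augmentations *)

Section Augmentations.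
Variable T : topologicalType.
Implicit Types A S W : set T.

Lemma sub_boundary_interior W : W `<=` boundary W `|` interior W.
Proof.
move=> x Wx; have [|nWx] := pselect (interior W x); first by right.
by left; split=> //; exact: subset_closure.
Qed.

(** Off the boundary, [W] and its interior have the same trace on [A], which is therefore clopen in
    [A]. *)
Lemma connected_sub_interior A W : closed W -> connected A ->
  A `&` boundary W = set0 -> A `&` W !=set0 -> A `<=` interior W.
Proof.
move=> Wcl Acon Abd AW.
have AWi : A `&` W = A `&` interior W.
  apply/seteqP; split=> [x [Ax Wx]|x [Ax /interior_subset]]; last by [].
  by split=> //; have [bx|//] := sub_boundary_interior Wx; have : set0 x by rewrite -Abd.
have <- : A `&` W = A.
  apply: Acon => //; first by exists (interior W) => //; exact: open_interior.
  by exists W.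
by rewrite AWi => x [].
Qed.

Lemma augmentations_meet S1 S2 W1 W2 : connected [set: T] ->
  connected S1 -> connected S2 -> connected W1 -> connected W2 ->
  closed W1 -> closed W2 -> augmentation S1 W1 -> augmentation S2 W2 ->
  W1 `|` W2 <> [set: T] -> W1 `&` W2 !=set0 ->
  [\/ S1 `&` S2 !=set0,
      W1 `<=` W2 /\ ~ (W1 `&` S2 !=set0) |
      W2 `<=` W1 /\ ~ (W2 `&` S1 !=set0)].
Proof.
move=> Tcon S1con S2con W1con W2con W1cl W2cl [bd1 SW1] [bd2 SW2] WT W12.
have [S12|nS12] := pselect (S1 `&` S2 !=set0); first by constructor 1.
have disj A S W : boundary W `<=` S -> ~ (A `&` S !=set0) -> A `&` boundary W = set0.
  by move=> bdW nAS; apply/seteqP; split=> // x [Ax /bdW Sx]; apply: nAS; exists x.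
have [W2S1|nW2S1] := pselect (W2 `&` S1 !=set0); last first.
  constructor 3; split=> //; apply: (subset_trans _ (@interior_subset _ W1)).
  apply: connected_sub_interior => //; [exact: disj _ _ _ bd1 nW2S1|by rewrite setIC].
have [W1S2|nW1S2] := pselect (W1 `&` S2 !=set0); last first.
  constructor 2; split=> //; apply: (subset_trans _ (@interior_subset _ W2)).
  by apply: connected_sub_interior => //; exact: disj _ _ _ bd2 nW1S2.
have S1W2 : S1 `<=` interior W2.
  by apply: connected_sub_interior => //; [exact: disj _ _ _ bd2 nS12|rewrite setIC].
have S2W1 : S2 `<=` interior W1.
  apply: connected_sub_interior => //; last by rewrite setIC.
  by apply: disj _ _ _ bd1 _; rewrite setIC.
(* Boundary points of [W1] lie in [S1], hence in the interior of [W2], and vice versa. So the union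
   of [W1] and [W2] is that of their interiors, and is clopen. *)
case: WT; rewrite -[LHS]setTI; apply: Tcon.
- by rewrite setTI; case: W12 => x [W1x _]; exists x; left.
- exists (interior W1 `|` interior W2); first by apply: openU; exact: open_interior.
  congr setI; apply/seteqP; split=> x; last first.
    by move=> [/interior_subset|/interior_subset]; [left|right].
  by move=> [/sub_boundary_interior[/bd1/S1W2|]|/sub_boundary_interior[/bd2/S2W1|]];
    [right|left|left|right].
- by exists (W1 `|` W2) => //; exact: closedU.
Qed.

End Augmentations.

(** * A family against its augmentations *)

Section Comparison.
Variables (T : topologicalType) (I : Type) (F W : I -> set T).
Hypothesis T_connected : connected [set: T].
Hypotheses (F_ne : forall i, F i !=set0) (F_connected : forall i, connected (F i)).
Hypotheses (W_connected : forall i, connected (W i)) (W_closed : forall i, closed (W i)).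
Hypothesis W_aug : forall i, augmentation (F i) (W i).
Hypothesis W_noncover : forall i j, W i `|` W j <> [set: T].

Definition in_hole (i j : I) : Prop := W i `<=` W j /\ ~ (W i `&` F j !=set0).

Lemma sub_aug i : F i `<=` W i.
Proof. by case: (W_aug i). Qed.

Lemma in_hole_trans i j k : in_hole i j -> in_hole j k -> in_hole i k.
Proof.
move=> [ij _] [jk njk]; split; first exact: subset_trans ij jk.
by move=> [x [/ij Wx Fx]]; apply: njk; exists x.
Qed.

Lemma in_hole_apart i j : in_hole i j -> ~ touch F i j.
Proof. by move=> [_ nij] [x [/sub_aug Wx Fx]]; apply: nij; exists x. Qed.

Lemma touchW i j : touch W i j -> [\/ touch F i j, in_hole i j | in_hole j i].
Proof.
by move=> ij; apply: augmentations_meet.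
Qed.

Lemma in_hole_upper i j k : in_hole i j -> in_hole i k ->
  touch_or_nested (touch F) in_hole j k.
Proof.
move=> [ij _] [ik _]; apply: touchW; have [x /sub_aug Wx] := F_ne i.
by exists x; split; [exact: ij|exact: ik].
Qed.

(** [W k] meets [W j], so [touchW] applies; if [j] were in a hole of [k], so would be [i], which
    touches [k]. *)
Lemma in_hole_absorb i j k : touch F i k -> in_hole i j -> touch F k j \/ in_hole k j.
Proof.
move=> [x [Fix Fkx]] ij; have [ijW _] := ij.
have kj : touch W k j by exists x; split; [exact: sub_aug|apply: ijW; exact: sub_aug].
have [kjF|hkj|jk] := touchW kj; [by left|by right|].
by have [] := in_hole_apart (in_hole_trans ij jk); exists x.
Qed.

Lemma touch_augE : touch W = touch_or_nested (touch F) in_hole.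
Proof.
apply/funext => i; apply/funext => j; apply/propext; split; first exact: touchW.
have [xi /sub_aug Wi] := F_ne i; have [xj /sub_aug Wj] := F_ne j.
move=> [[x [/sub_aug Fx /sub_aug Fy]]|[ij _]|[ji _]].
- by exists x.
- by exists xi; split=> //; exact: ij.
- by exists xj; split=> //; exact: ji.
Qed.

Lemma uniform_coloring_augment m :
  uniform_coloring (touch F) m -> uniform_coloring (touch W) m.
Proof.
move=> col r /col[b bP]; exists b.+2 => D; apply: bounded_coloring_compact => s.
have [h [hD _]] := part_ranked D s in_hole_trans (lt_irr (touch_refl F_ne) in_hole_apart).
have [rho rhoP] := retraction_exists in_hole_trans hD.
have [c cP] := bP (maximal in_hole (part D s)).
exists (c \o rho); rewrite touch_augE.
apply: bounded_coloring_nested rhoP cP; rewrite //=.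
- exact: touch_refl.
- exact: touch_sym.
- exact: in_hole_trans.
- exact: in_hole_absorb.
- exact: in_hole_upper.
Qed.

Lemma uniform_coloring_unaugment m :
  uniform_coloring (touch W) m -> uniform_coloring (touch F) (maxn m 1).
Proof.
move=> col r r0; have [|b bP] := col (3 * r + 6)%N; first by lia.
exists (2 * radius_bound r b)%N => D; apply: bounded_coloring_compact => s.
have [h [hD hs]] := part_ranked D s in_hole_trans (lt_irr (touch_refl F_ne) in_hole_apart).
(* Collars take a second colour, hence [maxn m 1]: then [ord0] and [ord_max] differ. *)
pose other (k : 'I_(maxn m 1).+1) := if k == ord0 then ord_max else ord0 : 'I_(maxn m 1).+1.
have other_neq k : other k <> k.
  rewrite /other; case: eqP => [-> /(congr1 val) /=|k0 /esym//]; lia.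
have mM : (m.+1 <= (maxn m 1).+1)%N by lia.
apply: (layered_coloring (touch_refl F_ne) (@touch_sym _ _ F) in_hole_trans
  in_hole_absorb in_hole_upper other_neq _ ord0 hD (fun x _ => hs x)).
(* On an antichain [touch W] and [touch F] coincide, so a colouring for [W] serves as base, its
   colours embedded among the new ones. *)
move=> M _ M_anti; have [c cP] := bP M; exists (widen_ord mM \o c).
apply: (bounded_coloring_antichain M_anti); rewrite -touch_augE => x y Mx xy.
apply: (cP x y Mx); apply: (proj2 (star_map (f := id) (A := setT) _ _ xy)) => // u v _.
by move=> [Mu Mv /(congr1 val) /= cuv uv]; split=> //; split=> //; exact: val_inj.
Qed.

End Comparison.

(** * The two inequalities *)

Lemma int_asdimE (R : realType) (T I : Type) (F : I -> set T) :
  (forall i, F i !=set0) ->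
  int_asdim R F = ereal_inf [set m%:R%:E | m in uniform_coloring (touch F)].
Proof.
move=> F_ne; congr ereal_inf; apply/seteqP.
by split=> _ [m /(asdim_atmostP F_ne) mF <-]; exists m => //; apply/(asdim_atmostP F_ne).
Qed.

Theorem theorem1p9 (R : realType) (T : topologicalType) (I J : Type)
    (F : I -> set T) (F' : J -> set T)
    (T_connected : connected [set: T])
    (F_ne : forall i, F i !=set0) (F_connected : forall i, connected (F i))
    (F'_ne : forall j, F' j !=set0) (F'_connected : forall j, connected (F' j))
    (F'_aug : augmentation_family F F') (F'_closed : closed_family F')
    (F'_noncover : forall D : set J,
      finite_set D -> \bigcup_(j in D) F' j <> [set: T]) :
  (int_asdim R F' <= int_asdim R F)%E /\
  (int_asdim R F <= maxe (int_asdim R F') 1)%E.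
Proof.
case: F'_aug => w [[g wK gK] w_aug]; pose W := F' \o w.
have W_noncover i j : W i `|` W j <> [set: T].
  have := F'_noncover [set w i; w j] (finite_set2 _ _).
  by rewrite bigcup_setU !bigcup_set1.
have W_connected i : connected (W i) by exact: F'_connected.
have W_closed i : closed (W i) by exact: F'_closed.
have W_F' m : uniform_coloring (touch W) m <-> uniform_coloring (touch F') m.
  split=> [/(uniform_coloring_pull gK wK)|/(uniform_coloring_pull wK gK)//].
  suff -> : (fun i j => touch W (g i) (g j)) = touch F' by [].
  by apply/funext => i; apply/funext => j; rewrite /touch /W /= !gK.
rewrite !int_asdimE //; split.
  apply: ereal_inf_le_tmp => _ [m mF <-]; exists m => //; apply/W_F'.
  exact: uniform_coloring_augment mF.
(* Without any such [m] the right-hand side is infinite; otherwise the least one is the dimension of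
   [F']. *)
have [ex|nex] := pselect (exists m, uniform_coloring (touch F') m); last first.
  have -> : [set m%:R%:E | m in uniform_coloring (touch F')] = set0 :> set (\bar R).
    by apply/seteqP; split=> // x [m mF]; case: nex; exists m.
  by rewrite ereal_inf0 maxye leey.
have [m /asboolP mF m_min] : exists2 m, `[< uniform_coloring (touch F') m >] &
    forall n, `[< uniform_coloring (touch F') n >] -> (m <= n)%N.
  have ex' : exists m, `[< uniform_coloring (touch F') m >].
    by case: ex => m mF; exists m; apply/asboolP.
  by exists (ex_minn ex'); case: ex_minnP.
apply: (@le_trans _ _ (maxn m 1)%:R%:E).
  apply: ereal_inf_lbound; exists (maxn m 1) => //.
  apply: (uniform_coloring_unaugment (F := F) (W := W)) => //; exact/W_F'.
have m_inf :
    (m%:R%:E <= ereal_inf [set n%:R%:E | n in uniform_coloring (touch F')] :> \bar R)%E.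
  by apply/ereal_infP => _ [n nF <-]; rewrite lee_fin ler_nat m_min//; apply/asboolP.
rewrite le_max; have [m1|m1] := leqP 1 m.
  by rewrite m_inf.
by rewrite lexx orbT.
Qed.
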